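(* In $\mathbf{ZF}$, the following conditions are equivalent: (i) $[\omega_1]^{\leq\omega}$ is a $\sigma$-ideal; (ii) $\mathrm{cf}(\aleph_1)=\aleph_1$ (that is, $\omega_1$ is regular); (iii) $\mathbf{S}_{\mathcal{P}}(\omega_1,[\omega_1]^{\leq\omega})$ and $2^{\omega_1}[[\omega_1]^{\leq\omega}]$ are both $P$-spaces; (iv) $\mathbf{S}(\omega_1,[\omega_1]^{\leq\omega})$ is a $P$-space.
   Context: The background theory is $\mathbf{ZF}$ (no axiom of choice). $\omega_1$ is the first uncountable ordinal. $[X]^{<\omega}$, $[X]^{\leq\omega}$ are the sets of finite, respectively countable, subsets of $X$. A $\sigma$-ideal is an ideal of sets closed under unions of sequences indexed by $\omega$. For an infinite set $X$, $\mathcal{Z}=[X]^{\leq\omega}$ and $\mathcal{A}\subseteq\mathcal{P}(X)$, $\mathbf{S}_{\mathcal{A}}(X,\mathcal{Z})$ is the set $\mathcal{A}$ with the topology consisting of all $V\subseteq\mathcal{A}$ such that for every $x\in V$ there is $z\in\mathcal{Z}$ with $x\cap z=\emptyset$ and $\{y\in\mathcal{A}:x\subseteq y\subseteq X\setminus z\}\subseteq V$. $\mathbf{S}_{\mathcal{P}}(X,\mathcal{Z})=\mathbf{S}_{\mathcal{P}(X)}(X,\mathcal{Z})$, $\mathbf{S}(X,\mathcal{Z})=\mathbf{S}_{[X]^{<\omega}}(X,\mathcal{Z})$. $2=\{0,1\}$. For $z\in\mathcal{Z}\setminus\{\emptyset\}$ and $p\in 2^z$, $[p]_X=\{f\in 2^X:p\subseteq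 f\}$. $2^X[\mathcal{Z}]$ is the set $2^X$ with the topology $\{V\subseteq 2^X:(\forall f\in V)(\exists z\in\mathcal{Z}\setminus\{\emptyset\})(\exists p\in 2^z)\ f\in[p]_X\subseteq V\}$. A $P$-space is a topological space in which every $G_\delta$-set (countable intersection of open sets) is open. *)

(* Defs.v *)
From Stdlib Require Import ClassicalEpsilon.

(* "ZF proves S" is rendered as "S holds in every model of first-order ZF"
   (the two agree by the completeness theorem).  Separation and Replacement are
   required only for formulas of the language {=, mem} with parameters: requiring
   them for arbitrary predicates [M -> Prop] would transfer the choice principles
   of the metatheory to the model, and the statement would lose its content. *)

Record set_structure : Type := SetStructure {
  carrier :> Type;
  mem : carrier -> carrier -> Prop;
  carrier_inhabited : inhabited carrier
}.

Arguments mem {s} x y.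

Declare Scope zf_scope.
Delimit Scope zf_scope with zf.
Local Open Scope zf_scope.

Notation "x ∈ y" := (mem x y) (at level 70, no associativity) : zf_scope.
Notation "x ∉ y" := (~ mem x y) (at level 70, no associativity) : zf_scope.

(* Variables are de Bruijn indices. *)
Inductive formula : Type :=
| FEq (i j : nat)
| FMem (i j : nat)
| FNot (p : formula)
| FAnd (p q : formula)
| FOr (p q : formula)
| FImp (p q : formula)
| FAll (p : formula)
| FEx (p : formula).

Definition scons {T : Type} (x : T) (v : nat -> T) (n : nat) : T :=
  match n with O => x | S k => v k end.

Fixpoint sat (M : set_structure) (v : nat -> M) (p : formula) : Prop :=
  match p with
  | FEq i j => v i = v j
  | FMem i j => v i ∈ v j
  | FNot p => ~ sat M v p
  | FAnd p q => sat M v p /\ sat M v q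
  | FOr p q => sat M v p \/ sat M v q
  | FImp p q => sat M v p -> sat M v q
  | FAll p => forall x : M, sat M (scons x v) p
  | FEx p => exists x : M, sat M (scons x v) p
  end.

Definition subset {M : set_structure} (x y : M) : Prop :=
  forall u : M, u ∈ x -> u ∈ y.

Notation "x ⊆ y" := (subset x y) (at level 70, no associativity) : zf_scope.

Record ZF (M : set_structure) : Prop := {
  zf_extensionality : forall x y : M, (forall u, u ∈ x <-> u ∈ y) -> x = y;
  zf_foundation : forall x : M, (exists y, y ∈ x) ->
    exists y, y ∈ x /\ ~ (exists u, u ∈ y /\ u ∈ x);
  zf_pairing : forall x y : M, exists z, forall u, u ∈ z <-> u = x \/ u = y;
  zf_union : forall x : M, exists z, forall u, u ∈ z <-> exists y, y ∈ x /\ u ∈ y;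
  zf_power : forall x : M, exists z, forall u, u ∈ z <-> u ⊆ x;
  zf_infinity : exists I : M,
    (exists e, e ∈ I /\ forall u, u ∉ e) /\
    (forall x, x ∈ I -> exists s, s ∈ I /\ forall u, u ∈ s <-> u ∈ x \/ u = x);
  zf_separation : forall (p : formula) (v : nat -> M) (a : M),
    exists b, forall x, x ∈ b <-> x ∈ a /\ sat M (scons x v) p;
  zf_replacement : forall (p : formula) (v : nat -> M) (a : M),
    (forall x y y', x ∈ a -> sat M (scons x (scons y v)) p ->
       sat M (scons x (scons y' v)) p -> y = y') ->
    exists b, forall y,
      y ∈ b <-> exists x, x ∈ a /\ sat M (scons x (scons y v)) p
}.

(* The set of [M] whose members are exactly the [x] with [P x]; it is unique by
   extensionality, and unspecified if [M] has no such set.  It is only applied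
   below to classes that ZF proves to be sets. *)
Definition setof {M : set_structure} (P : M -> Prop) : M :=
  epsilon (carrier_inhabited M) (fun s => forall x, x ∈ s <-> P x).

Notation "{{ x | P }}" := (setof (fun x => P)) (at level 0, x name) : zf_scope.

Definition empty {M : set_structure} : M := {{ x | False }}.
Definition pair {M : set_structure} (x y : M) : M := {{ u | u = x \/ u = y }}.
Definition opair {M : set_structure} (x y : M) : M := pair (pair x x) (pair x y).
Definition bigcup {M : set_structure} (x : M) : M :=
  {{ u | exists y, y ∈ x /\ u ∈ y }}.
Definition cup {M : set_structure} (x y : M) : M := {{ u | u ∈ x \/ u ∈ y }}.
Definition cap {M : set_structure} (x y : M) : M := {{ u | u ∈ x /\ u ∈ y }}.
Definition diff {M : set_structure} (x y : M) : M := {{ u | u ∈ x /\ u ∉ y }}.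
Definition pow {M : set_structure} (x : M) : M := {{ u | u ⊆ x }}.
Definition succ {M : set_structure} (x : M) : M := {{ u | u ∈ x \/ u = x }}.

Definition inductive_set {M : set_structure} (I : M) : Prop :=
  empty ∈ I /\ forall x, x ∈ I -> succ x ∈ I.

Definition omega {M : set_structure} : M :=
  {{ n | forall I, inductive_set I -> n ∈ I }}.

Definition two {M : set_structure} : M := succ (succ empty).

Definition is_function {M : set_structure} (f a b : M) : Prop :=
  (forall p, p ∈ f -> exists x y, x ∈ a /\ y ∈ b /\ p = opair x y) /\
  (forall x, x ∈ a -> exists! y, opair x y ∈ f).

Definition is_injection {M : set_structure} (f a b : M) : Prop :=
  is_function f a b /\
  forall x x' y, opair x y ∈ f -> opair x' y ∈ f -> x = x'.

Definition is_bijection {M : set_structure} (f a b : M) : Prop :=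
  is_injection f a b /\ forall y, y ∈ b -> exists x, opair x y ∈ f.

Definition range {M : set_structure} (f : M) : M :=
  {{ y | exists x, opair x y ∈ f }}.

Definition funs {M : set_structure} (a b : M) : M := {{ f | is_function f a b }}.

Definition finite {M : set_structure} (a : M) : Prop :=
  exists n f, n ∈ omega /\ is_bijection f a n.

Definition countable {M : set_structure} (a : M) : Prop :=
  exists f, is_injection f a omega.

Definition finite_subsets {M : set_structure} (X : M) : M :=
  {{ z | z ⊆ X /\ finite z }}.

Definition countable_subsets {M : set_structure} (X : M) : M :=
  {{ z | z ⊆ X /\ countable z }}.

Definition transitive_set {M : set_structure} (a : M) : Prop :=
  forall x, x ∈ a -> x ⊆ a.

Definition well_ordered_by_mem {M : set_structure} (a : M) : Prop :=
  (forall x, x ∈ a -> x ∉ x) /\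
  (forall x y z, x ∈ a -> y ∈ a -> z ∈ a -> x ∈ y -> y ∈ z -> x ∈ z) /\
  (forall x y, x ∈ a -> y ∈ a -> x ∈ y \/ x = y \/ y ∈ x) /\
  (forall s, s ⊆ a -> s <> empty ->
     exists m, m ∈ s /\ forall y, y ∈ s -> m = y \/ m ∈ y).

Definition ordinal {M : set_structure} (a : M) : Prop :=
  transitive_set a /\ well_ordered_by_mem a.

(* The ordinals smaller than [w] are the members of [w]. *)
Definition first_uncountable_ordinal {M : set_structure} (w : M) : Prop :=
  ordinal w /\ ~ countable w /\ forall a, a ∈ w -> countable a.

Definition cofinal_map {M : set_structure} (f b a : M) : Prop :=
  is_function f b a /\
  forall x, x ∈ a -> exists t y, opair t y ∈ f /\ (x = y \/ x ∈ y).

(* [cf(a) = b]: [b] is the least ordinal that is mapped cofinally into [a]. *)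
Definition is_cofinality {M : set_structure} (a b : M) : Prop :=
  ordinal b /\ (exists f, cofinal_map f b a) /\
  forall c, c ∈ b -> ~ exists f, cofinal_map f c a.

Definition ideal {M : set_structure} (I : M) : Prop :=
  empty ∈ I /\
  (forall x y, x ∈ I -> y ⊆ x -> y ∈ I) /\
  (forall x y, x ∈ I -> y ∈ I -> cup x y ∈ I).

Definition sigma_ideal {M : set_structure} (I : M) : Prop :=
  ideal I /\ forall s, is_function s omega I -> bigcup (range s) ∈ I.

Definition topology {M : set_structure} (A tau : M) : Prop :=
  tau ⊆ pow A /\ empty ∈ tau /\ A ∈ tau /\
  (forall F, F ⊆ tau -> bigcup F ∈ tau) /\
  (forall V W, V ∈ tau -> W ∈ tau -> cap V W ∈ tau).

Definition G_delta {M : set_structure} (A tau G : M) : Prop :=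
  exists F, countable F /\ F ⊆ tau /\
    G = {{ x | x ∈ A /\ forall V, V ∈ F -> x ∈ V }}.

Definition P_space {M : set_structure} (A tau : M) : Prop :=
  topology A tau /\ forall G, G_delta A tau G -> G ∈ tau.

(* The topology of [S_A(X, Z)], whose underlying set is [A]. *)
Definition S_topology {M : set_structure} (A X Z : M) : M :=
  {{ V | V ⊆ A /\ forall x, x ∈ V -> exists z, z ∈ Z /\ cap x z = empty /\
           {{ y | y ∈ A /\ x ⊆ y /\ y ⊆ diff X z }} ⊆ V }}.

Definition cylinder {M : set_structure} (X p : M) : M :=
  {{ f | f ∈ funs X two /\ p ⊆ f }}.

(* The topology of [2^X[Z]], whose underlying set is [funs X two]. *)
Definition cylinder_topology {M : set_structure} (X Z : M) : M :=
  {{ V | V ⊆ funs X two /\ forall f, f ∈ V ->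
           exists z p, z ∈ Z /\ z <> empty /\ p ∈ funs z two /\
             f ∈ cylinder X p /\ cylinder X p ⊆ V }}.

(* Main.v *)
(** Each of the four conditions says that a countable subset of [w1] is bounded
    and that countably many ordinals below [w1] have a common bound below [w1].
    If [w1] is regular, the countable subsets of [w1] are exactly the bounded
    ones, and the neighbourhoods of a point in the topologies considered have
    bases that decrease along [w1]; so the least index that works can be taken
    for each member of a countable family of open sets, and a common bound of
    these indices works for all of them, without any choice.  Conversely, let
    [f : c -> w1] be cofinal with [c] in [w1].  Then [w1] is the countable union
    of the countable sets [succ (f t)], against the sigma-ideal property; and
    the open sets of those [y] that miss [succ (f t)] intersect in [{empty}],
    which is not open because [w1] is uncountable.

    Separation is available only for first-order formulas, so the predicates
    used must be definable with parameters. *)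

From Stdlib Require Import Classical ClassicalEpsilon FunctionalExtensionality PropExtensionality PeanoNat.
Require Import Defs.

Local Open Scope zf_scope.

(** * Renaming of variables in formulas *)

Fixpoint rename (f : nat -> nat) (p : formula) : formula :=
  let up g := fun n => match n with O => O | S k => S (g k) end in
  match p with
  | FEq i j => FEq (f i) (f j)
  | FMem i j => FMem (f i) (f j)
  | FNot p => FNot (rename f p)
  | FAnd p q => FAnd (rename f p) (rename f q)
  | FOr p q => FOr (rename f p) (rename f q)
  | FImp p q => FImp (rename f p) (rename f q)
  | FAll p => FAll (rename (up f) p)
  | FEx p => FEx (rename (up f) p)
  end.

Lemma sat_rename (M : set_structure) (p : formula) :
  forall (f : nat -> nat) (v : nat -> M),
  sat M v (rename f p) <-> sat M (fun n => v (f n)) p.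
Proof.
  induction p; intros f v; simpl; try tauto;
    try (rewrite ?IHp, ?IHp1, ?IHp2; tauto).
  all: assert (E : forall x : M, (fun n => scons x v
      match n with O => O | S k => S (f k) end) = scons x (fun n => v (f n)))
    by (intro x; apply functional_extensionality; intros []; reflexivity).
  - split; intros H x; specialize (H x); rewrite IHp, E in *; exact H.
  - split; intros [x H]; exists x; rewrite IHp, E in *; exact H.
Qed.

(** * First-order definability with parameters *)

Section Model.
Context {M : set_structure}.

Definition lookup (v : nat -> M) (s : nat + M) : M :=
  match s with inl n => v n | inr a => a end.

Definition tl (v : nat -> M) (n : nat) : M := v (S n).

(* [r] tells which free variables of [p] are variables of [P] and which are
   parameters. *)
Definition definable (P : (nat -> M) -> Prop) : Prop :=
  exists (p : formula) (r : nat -> nat + M),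
    forall v, sat M (fun i => lookup v (r i)) p <-> P v.

(** The language has no function symbols, so a term is handled through its graph: the value sits at
    index 0 and the arguments are shifted up by one. *)
Definition definable_term (t : (nat -> M) -> M) : Prop :=
  definable (fun v => v 0 = t (tl v)).

Lemma definable_ext (P Q : (nat -> M) -> Prop) :
  (forall v, P v <-> Q v) -> definable P -> definable Q.
Proof.
  intros E [p [r H]]. exists p, r. intro v. rewrite H. apply E.
Qed.

Lemma definable_rename (f : nat -> nat) (P : (nat -> M) -> Prop) :
  definable P -> definable (fun v => P (fun n => v (f n))).
Proof.
  intros [p [r H]].
  exists p, (fun i => match r i with inl n => inl (f n) | inr a => inr a end).
  intro v. rewrite <- H.
  replace (fun i => lookup v _) with
    (fun i => lookup (fun n => v (f n)) (r i)); [tauto|].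
  apply functional_extensionality; intro i. destruct (r i); reflexivity.
Qed.

(** By excluded middle [P] is true or false, and a valid or a contradictory formula expresses it.
    This holds even when [P] itself is not a first-order statement about [M]. *)
Lemma definable_const (P : Prop) : definable (fun _ => P).
Proof.
  destruct (classic P) as [H|H].
  - exists (FEq 0 0), (fun _ => inl 0). simpl. tauto.
  - exists (FNot (FEq 0 0)), (fun _ => inl 0). simpl. tauto.
Qed.

Lemma definable_not P : definable P -> definable (fun v => ~ P v).
Proof.
  intros [p [r H]]. exists (FNot p), r. intro v. simpl. rewrite H. tauto.
Qed.

(* Variable [i] of the first formula becomes [2 i], that of the second
   [2 i + 1]. *)
Lemma definable_and P Q :
  definable P -> definable Q -> definable (fun v => P v /\ Q v).
Proof.
  intros [p [r H]] [q [s K]].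
  exists (FAnd (rename (fun i => 2 * i) p) (rename (fun i => 2 * i + 1) q)),
    (fun i => if Nat.even i then r (Nat.div2 i) else s (Nat.div2 i)).
  intro v. simpl. rewrite !sat_rename, <- H, <- K.
  assert (E1 : (fun n => lookup v (if Nat.even (2 * n)
     then r (Nat.div2 (2 * n)) else s (Nat.div2 (2 * n))))
     = (fun i => lookup v (r i))).
  { apply functional_extensionality; intro i.
    rewrite Nat.even_mul, Nat.div2_double. reflexivity. }
  assert (E2 : (fun n => lookup v (if Nat.even (2 * n + 1)
     then r (Nat.div2 (2 * n + 1)) else s (Nat.div2 (2 * n + 1))))
     = (fun i => lookup v (s i))).
  { apply functional_extensionality; intro i.
    rewrite Nat.even_add, Nat.even_mul, Nat.add_1_r, Nat.div2_succ_double.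
    reflexivity. }
  simpl in E1, E2. rewrite E1, E2. tauto.
Qed.

Lemma definable_or P Q :
  definable P -> definable Q -> definable (fun v => P v \/ Q v).
Proof.
  intros HP HQ. apply definable_ext with (fun v => ~ (~ P v /\ ~ Q v)).
  - intro v. tauto.
  - apply definable_not, definable_and; apply definable_not; assumption.
Qed.

Lemma definable_imp P Q :
  definable P -> definable Q -> definable (fun v => P v -> Q v).
Proof.
  intros HP HQ. apply definable_ext with (fun v => ~ P v \/ Q v).
  - intro v. tauto.
  - apply definable_or; [apply definable_not|]; assumption.
Qed.

Lemma definable_iff P Q :
  definable P -> definable Q -> definable (fun v => P v <-> Q v).
Proof. intros; apply definable_and; apply definable_imp; assumption. Qed.

Lemma definable_ex (P : M -> (nat -> M) -> Prop) :
  definable (fun v => P (v 0) (tl v)) -> definable (fun v => exists x, P x v).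
Proof.
  intros [p [r H]].
  (* Every variable of [p] that stands for [v 0] becomes the bound variable. The others move up past
     the quantifier, and their targets drop by one because [P] reads them through [tl]. *)
  exists (FEx (rename (fun i => match r i with inl 0 => 0 | _ => S i end) p)),
    (fun i => match r i with inl n => inl (pred n) | inr a => inr a end).
  intro v. simpl.
  enough (E : forall x, sat M (scons x (fun i => lookup v
      match r i with inl n => inl (pred n) | inr a => inr a end))
      (rename (fun i => match r i with inl 0 => 0 | _ => S i end) p)
      <-> P x v).
  { split; intros [x K]; exists x; apply E, K. }
  intro x. rewrite sat_rename.
  change (P x v) with (P (scons x v 0) (tl (scons x v))). rewrite <- H.
  replace (fun n => scons x _ _) with (fun i => lookup (scons x v) (r i));
    [tauto|].
  apply functional_extensionality; intro i.
  destruct (r i) as [[|n]|a] eqn:Ei; simpl; rewrite ?Ei; reflexivity.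
Qed.

Lemma definable_all (P : M -> (nat -> M) -> Prop) :
  definable (fun v => P (v 0) (tl v)) -> definable (fun v => forall x, P x v).
Proof.
  intro H. apply definable_ext with (fun v => ~ exists x, ~ P x v).
  - intro v. split; [intros K x; apply NNPP; eauto | firstorder].
  - apply definable_not, definable_ex, definable_not, H.
Qed.

Lemma definable_subst (P : M -> (nat -> M) -> Prop) t :
  definable (fun v => P (v 0) (tl v)) -> definable_term t ->
  definable (fun v => P (t v) v).
Proof.
  intros HP Ht. apply definable_ext with (fun v => exists x, x = t v /\ P x v).
  - intro v. split; [intros [x [-> K]]; exact K | eauto].
  - apply definable_ex, definable_and; assumption.
Qed.

Lemma definable_term_tl t :
  definable_term t -> definable_term (fun v => t (tl v)).
Proof.
  exact (definable_rename (fun n => match n with O => O | S k => S (S k) end) _).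
Qed.

Lemma definable_rel1 (R : M -> Prop) a :
  definable (fun v => R (v 0)) -> definable_term a ->
  definable (fun v => R (a v)).
Proof. exact (definable_subst (fun x _ => R x) a). Qed.

(** Arguments are substituted from first to last and each new variable takes index 0, so the
    variables arrive in reverse order; the final renaming restores the order. The case of three
    arguments works in the same way. *)
Lemma definable_rel2 (R : M -> M -> Prop) a b :
  definable (fun v => R (v 0) (v 1)) -> definable_term a -> definable_term b ->
  definable (fun v => R (a v) (b v)).
Proof.
  intros HR Ha Hb. apply (definable_subst (fun x v => R x (b v)) a); [|exact Ha].
  apply (definable_subst (fun y v => R (v 0) y) (fun v => b (tl v)));
    [|apply definable_term_tl, Hb].
  exact (definable_rename (fun n => match n with O => 1 | _ => 0 end) _ HR).
Qed.

Lemma definable_rel3 (R : M -> M -> M -> Prop) a b c :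
  definable (fun v => R (v 0) (v 1) (v 2)) ->
  definable_term a -> definable_term b -> definable_term c ->
  definable (fun v => R (a v) (b v) (c v)).
Proof.
  intros HR Ha Hb Hc.
  apply (definable_subst (fun x v => R x (b v) (c v)) a); [|exact Ha].
  apply (definable_subst (fun y v => R (v 0) y (c (tl v))) (fun v => b (tl v)));
    [|apply definable_term_tl, Hb].
  apply (definable_subst (fun z v => R (v 1) (v 0) z) (fun v => c (tl (tl v))));
    [|apply (definable_term_tl (fun v => c (tl v))), definable_term_tl, Hc].
  exact (definable_rename
    (fun n => match n with O => 2 | 1 => 1 | _ => 0 end) _ HR).
Qed.

Lemma definable_var i : definable_term (fun v => v i).
Proof. exists (FEq 0 1), (fun n => inl (match n with O => 0 | _ => S i end)).
  intro v. simpl. unfold tl. tauto. Qed.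

Lemma definable_par a : definable_term (fun _ => a).
Proof. exists (FEq 0 1), (fun n => match n with O => inl 0 | _ => inr a end).
  intro v. simpl. tauto. Qed.

Lemma definable_mem a b : definable_term a -> definable_term b ->
  definable (fun v => a v ∈ b v).
Proof.
  apply (definable_rel2 mem). exists (FMem 0 1), inl. simpl. tauto.
Qed.

Lemma definable_eq a b : definable_term a -> definable_term b ->
  definable (fun v => a v = b v).
Proof.
  apply (definable_rel2 eq). exists (FEq 0 1), inl. simpl. tauto.
Qed.

(** * Comprehension and the basic set operations *)

Context (HM : ZF M).

Lemma setof_spec (P : M -> Prop) :
  (exists s, forall x, x ∈ s <-> P x) -> forall x, x ∈ {{ x | P x }} <-> P x.
Proof. intro H. exact (epsilon_spec (carrier_inhabited M) _ H). Qed.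

(* All predicates that define no set are sent by [setof] to one and the same
   value, which serves as a parameter. *)
Lemma definable_setof (P : M -> (nat -> M) -> Prop) :
  definable (fun v => P (v 0) (tl v)) ->
  definable_term (fun v => {{ x | P x v }}).
Proof.
  intro H.
  set (junk := epsilon (carrier_inhabited M) (fun _ : M => False)).
  assert (K : definable (fun v => forall x, x ∈ v 0 <-> P x (tl v))).
  { apply definable_all, definable_iff.
    - apply definable_mem; [apply (definable_var 0) | apply (definable_var 1)].
    - exact (definable_rename
        (fun n => match n with O => O | S k => S (S k) end) _ H). }
  apply definable_ext with (fun v =>
    (forall x, x ∈ v 0 <-> P x (tl v)) \/
    (~ (exists s, forall x, x ∈ s <-> P x (tl v)) /\ v 0 = junk)).
  - intro v. split.
    + intros [E | [N ->]].
      * apply (zf_extensionality _ HM). intro u. rewrite E.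
        symmetry. apply setof_spec with (P := fun x => P x (tl v)).
        exists (v 0). exact E.
      * unfold junk, setof. f_equal. apply functional_extensionality. intro s.
        apply propositional_extensionality. split; [tauto|eauto].
    + intro E. destruct (classic (exists s, forall x, x ∈ s <-> P x (tl v)))
        as [Y|N]; [left | right].
      * rewrite E. exact (setof_spec _ Y).
      * split; [exact N|]. rewrite E. unfold junk, setof. f_equal.
        apply functional_extensionality. intro s.
        apply propositional_extensionality. split; [eauto|tauto].
  - apply definable_or; [exact K|]. apply definable_and.
    + apply definable_not, definable_ex.
      exact (definable_rename
          (fun n => match n with O => O | S k => S (S k) end) _ K).
    + apply definable_eq; [apply definable_var | apply definable_par].
Qed.

(** The constant cases come first, so that whatever does not mention [v] is taken as a parameter.
    Abstract relations come last, through a definability hypothesis found in the context. *)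
Ltac definability_step :=
  lazymatch goal with
  | |- definable (fun _ => ?P) => apply definable_const
  | |- definable_term (fun _ => ?a) => apply definable_par
  | |- definable_term (fun v => v ?i) => apply (definable_var i)
  | |- definable_term (fun v => setof _) => apply definable_setof
  | |- definable (fun v => _ ∈ _) => apply definable_mem
  | |- definable (fun v => _ = _) => apply definable_eq
  | |- definable (fun v => ~ _) => apply definable_not
  | |- definable (fun v => _ /\ _) => apply definable_and
  | |- definable (fun v => _ \/ _) => apply definable_or
  | |- definable (fun v => _ <-> _) => apply definable_iff
  | |- definable (fun v => exists _, _) => apply definable_ex
  | |- _ => first
     [ apply definable_imp | apply definable_all
     | match goal with
       | H : definable (fun v => ?R (v 0) (v 1) (v 2)) |- _ =>
           apply (definable_rel3 R _ _ _ H)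
       | H : definable (fun v => ?R (v 0) (v 1)) |- _ =>
           apply (definable_rel2 R _ _ H)
       | H : definable (fun v => ?R (v 0)) |- _ =>
           apply (definable_rel1 R _ H)
       end ]
  end; unfold tl; cbv beta.

Ltac definability :=
  unfold countable, finite, is_bijection, is_injection, is_function, cup, cap,
    diff, pow, succ, opair, pair, subset, unique;
  repeat definability_step.

Lemma separation (P : M -> Prop) (a : M) : definable (fun v => P (v 0)) ->
  exists b, forall x, x ∈ b <-> x ∈ a /\ P x.
Proof.
  (* [P] looks at [v 0] only, so all variables of the formula may be merged into the one variable of
     Separation. Parameters move to the indices [S i], where the assignment supplies them. *)
  intros [p [r H]]. destruct (zf_separation _ HM
    (rename (fun i => match r i with inl _ => 0 | inr _ => S i end) p)
    (fun i => match r i with inl _ => a | inr c => c end) a) as [b Hb].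
  exists b. intro x. rewrite Hb, sat_rename, <- (H (fun _ => x)).
  replace (fun n => scons x _ _) with (fun i => lookup (fun _ => x) (r i));
    [tauto|].
  apply functional_extensionality; intro i.
  destruct (r i) eqn:Ei; simpl; rewrite ?Ei; reflexivity.
Qed.

(** Separation inside the bound [a] makes the class a set. Set abstractions that no axiom provides
    directly get their membership rule from here. *)
Lemma in_setof (a : M) (P : M -> Prop) : definable (fun v => P (v 0)) ->
  (forall x, P x -> x ∈ a) -> forall x, x ∈ {{ x | P x }} <-> P x.
Proof.
  intros HP Ha. apply setof_spec. destruct (separation P a HP) as [b Hb].
  exists b. intro x. rewrite Hb. firstorder.
Qed.

Lemma ext (x y : M) : (forall u, u ∈ x <-> u ∈ y) -> x = y.
Proof. apply (zf_extensionality _ HM). Qed.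

Lemma in_empty (u : M) : u ∉ empty.
Proof.
  enough (H : u ∈ empty <-> False) by tauto.
  (* Any set bounds the empty class; [u] is the one at hand. *)
  apply (in_setof u (fun _ => False)); [definability | tauto].
Qed.

Lemma eq_empty (x : M) : (forall u, u ∉ x) -> x = empty.
Proof. intro H. apply ext. intro u. pose proof (in_empty u). firstorder. Qed.

Lemma in_pair (x y u : M) : u ∈ pair x y <-> u = x \/ u = y.
Proof. apply setof_spec with (P := fun u => u = x \/ u = y), (zf_pairing _ HM). Qed.

Lemma in_bigcup (x u : M) : u ∈ bigcup x <-> exists y, y ∈ x /\ u ∈ y.
Proof.
  apply setof_spec with (P := fun u => exists y, y ∈ x /\ u ∈ y), (zf_union _ HM).
Qed.

Lemma in_pow (x u : M) : u ∈ pow x <-> u ⊆ x.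
Proof. apply setof_spec with (P := fun u => u ⊆ x), (zf_power _ HM). Qed.

Lemma in_cup (x y u : M) : u ∈ cup x y <-> u ∈ x \/ u ∈ y.
Proof.
  apply (in_setof (bigcup (pair x y)) (fun u => u ∈ x \/ u ∈ y)); [definability|].
  intros t [H|H]; apply in_bigcup; [exists x | exists y];
    rewrite in_pair; auto.
Qed.

Lemma in_cap (x y u : M) : u ∈ cap x y <-> u ∈ x /\ u ∈ y.
Proof.
  apply (in_setof x (fun u => u ∈ x /\ u ∈ y)); [definability | tauto].
Qed.

Lemma in_diff (x y u : M) : u ∈ diff x y <-> u ∈ x /\ u ∉ y.
Proof.
  apply (in_setof x (fun u => u ∈ x /\ u ∉ y)); [definability | tauto].
Qed.

Lemma in_succ (x u : M) : u ∈ succ x <-> u ∈ x \/ u = x.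
Proof.
  apply (in_setof (cup x (pair x x)) (fun u => u ∈ x \/ u = x)); [definability|].
  intros t [H|H]; rewrite in_cup, in_pair; auto.
Qed.

Lemma pair_inj (x y x' y' : M) : pair x y = pair x' y' ->
  (x = x' /\ y = y') \/ (x = y' /\ y = x').
Proof.
  intro E.
  assert (H : forall u, (u = x \/ u = y) <-> (u = x' \/ u = y')).
  { intro u. rewrite <- !in_pair, E. tauto. }
  pose proof (proj1 (H x)). pose proof (proj1 (H y)).
  pose proof (proj2 (H x')). pose proof (proj2 (H y')).
  intuition congruence.
Qed.

Lemma opair_inj (x y x' y' : M) : opair x y = opair x' y' -> x = x' /\ y = y'.
Proof.
  intro E. apply pair_inj in E. destruct E as [[A B]|[A B]];
    apply pair_inj in A; apply pair_inj in B; intuition congruence.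
Qed.

Lemma in_range (f y : M) : y ∈ range f <-> exists x, opair x y ∈ f.
Proof.
  apply (in_setof (bigcup (bigcup f)) (fun y => exists x, opair x y ∈ f));
    [definability|].
  (* By Kuratowski's encoding, a coordinate of a pair in [f] lies two unions below [f]. *)
  intros u [x H]. apply in_bigcup. exists (pair x u). rewrite in_pair.
  split; [|auto]. apply in_bigcup. exists (opair x u). unfold opair.
  rewrite in_pair. auto.
Qed.

Lemma opair_in_square (a b x y : M) : x ∈ a -> y ∈ b ->
  opair x y ∈ pow (pow (cup a b)).
Proof.
  intros Hx Hy. apply in_pow. intros u Hu. apply in_pow. intros t Ht.
  unfold opair in Hu. apply in_pair in Hu. rewrite in_cup.
  destruct Hu; subst; apply in_pair in Ht; destruct Ht; subst; auto.
Qed.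

Lemma in_funs (a b f : M) : f ∈ funs a b <-> is_function f a b.
Proof.
  apply (in_setof (pow (pow (pow (cup a b)))) (fun f => is_function f a b));
    [definability|].
  intros g [Hg _]. apply in_pow. intros p Hp.
  destruct (Hg p Hp) as (x & y & Hx & Hy & ->). apply opair_in_square; assumption.
Qed.

(** * Functions as sets of pairs *)

Lemma function_unique (f a b x y y' : M) : is_function f a b ->
  opair x y ∈ f -> opair x y' ∈ f -> y = y'.
Proof.
  intros [H1 H2] H H'. destruct (H1 _ H) as (s & t & Hs & _ & E).
  apply opair_inj in E. destruct E as [<- <-].
  destruct (H2 x Hs) as (u & _ & Hu). rewrite <- (Hu y H). apply Hu, H'.
Qed.

Lemma function_dom (f a b x y : M) : is_function f a b ->
  opair x y ∈ f -> x ∈ a /\ y ∈ b.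
Proof.
  intros [H1 _] H. destruct (H1 _ H) as (s & t & Hs & Ht & E).
  apply opair_inj in E. destruct E; subst; auto.
Qed.

Lemma function_total (f a b x : M) : is_function f a b -> x ∈ a ->
  exists y, y ∈ b /\ opair x y ∈ f.
Proof.
  intros Hf Hx. destruct (proj2 Hf x Hx) as (y & Hy & _). exists y.
  split; [apply (function_dom f a b x y Hf Hy) | exact Hy].
Qed.

(** The graph is cut out by Separation from the double power set of [cup a b]. Since [R] must
    already be single-valued, no choice enters when functions are built. *)
Lemma function_graph (R : M -> M -> Prop) (a b : M) :
  definable (fun v => R (v 0) (v 1)) ->
  (forall x, x ∈ a -> exists y, y ∈ b /\ R x y) ->
  (forall x y y', x ∈ a -> y ∈ b -> y' ∈ b -> R x y -> R x y' -> y = y') ->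
  exists f, is_function f a b /\
    forall x y, opair x y ∈ f <-> x ∈ a /\ y ∈ b /\ R x y.
Proof.
  intros HR Ht Hu.
  destruct (separation (fun p => exists x y, x ∈ a /\ y ∈ b /\ p = opair x y /\ R x y)
    (pow (pow (cup a b)))) as [f Hf]; [definability|].
  assert (E : forall x y, opair x y ∈ f <-> x ∈ a /\ y ∈ b /\ R x y).
  { intros x y. rewrite Hf. split.
    - intros (_ & s & t & Hs & Hy & E & H). apply opair_inj in E.
      destruct E; subst; auto.
    - intros (Hx & Hy & H). split; [apply opair_in_square; assumption|].
      exists x, y. auto. }
  exists f. split; [|exact E]. split.
  - intros p Hp. apply Hf in Hp. destruct Hp as (_ & x & y & ? & ? & ? & ?). eauto.
  - intros x Hx. destruct (Ht x Hx) as (y & Hy & H). exists y. split.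
    + apply E. auto.
    + intros y' Hy'. apply E in Hy'. apply (Hu x); tauto.
Qed.

(** * Foundation and the natural numbers *)

Lemma not_mem_self (x : M) : x ∉ x.
Proof.
  intro H. destruct (zf_foundation _ HM (pair x x)) as (y & Hy & N).
  - exists x. apply in_pair. auto.
  - apply in_pair in Hy. assert (y = x) by tauto. subst y.
    apply N. exists x. rewrite in_pair. auto.
Qed.

Lemma mem_asym (x y : M) : x ∈ y -> y ∉ x.
Proof.
  intros H H'. destruct (zf_foundation _ HM (pair x y)) as (z & Hz & N).
  - exists x. apply in_pair. auto.
  - apply N. apply in_pair in Hz. destruct Hz; subst z; [exists y | exists x];
      rewrite in_pair; auto.
Qed.

Lemma succ_inj (x y : M) : succ x = succ y -> x = y.
Proof.
  intro E. assert (Hx : x ∈ succ y) by (rewrite <- E, in_succ; auto).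
  assert (Hy : y ∈ succ x) by (rewrite E, in_succ; auto).
  rewrite in_succ in Hx, Hy. pose proof (mem_asym x y). intuition congruence.
Qed.

Lemma succ_neq_empty (x : M) : succ x <> empty.
Proof. intro E. apply (in_empty x). rewrite <- E, in_succ. auto. Qed.

Lemma exists_inductive : exists I : M, inductive_set I.
Proof.
  destruct (zf_infinity _ HM) as (I & (e & He & Ne) & Hs). exists I. split.
  - rewrite <- (eq_empty e Ne). exact He.
  - intros x Hx. destruct (Hs x Hx) as (s & Is & Es).
    replace (succ x) with s; [exact Is|]. apply ext. intro u.
    rewrite Es, in_succ. tauto.
Qed.

Lemma in_omega (n : M) : n ∈ omega <-> forall I, inductive_set I -> n ∈ I.
Proof.
  destruct exists_inductive as [J HJ].
  apply (in_setof J (fun n => forall I, inductive_set I -> n ∈ I)); [|auto].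
  unfold inductive_set. definability.
Qed.

Lemma empty_in_omega : empty ∈ (omega : M).
Proof. apply in_omega. intros I [H _]. exact H. Qed.

Lemma succ_in_omega (n : M) : n ∈ omega -> succ n ∈ omega.
Proof.
  rewrite !in_omega. intros H I HI. apply HI, H, HI.
Qed.

(** Definability makes the [n] in [omega] with [P n] a set; this set is inductive, so it contains
    [omega]. *)
Lemma omega_ind (P : M -> Prop) : definable (fun v => P (v 0)) ->
  P empty -> (forall n, n ∈ omega -> P n -> P (succ n)) ->
  forall n, n ∈ omega -> P n.
Proof.
  intros HP H0 HS n Hn. destruct (separation P omega HP) as [I HI].
  apply (HI n). apply in_omega; [exact Hn|]. split.
  - apply HI. split; [apply empty_in_omega | exact H0].
  - intros x Hx. apply HI in Hx. apply HI.
    split; [apply succ_in_omega | apply HS]; tauto.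
Qed.

Lemma omega_transitive : transitive_set (omega : M).
Proof.
  unfold transitive_set. apply (omega_ind (fun n => n ⊆ omega)).
  - definability.
  - intros u Hu. destruct (in_empty u Hu).
  - intros n Hn IH u Hu. apply in_succ in Hu. destruct Hu as [Hu| ->]; auto.
Qed.

(** * Countable and finite sets *)

Lemma countable_intro (R : M -> M -> Prop) (a : M) :
  definable (fun v => R (v 0) (v 1)) ->
  (forall x, x ∈ a -> exists n, n ∈ omega /\ R x n) ->
  (forall x n n', x ∈ a -> R x n -> R x n' -> n = n') ->
  (forall x x' n, x ∈ a -> x' ∈ a -> R x n -> R x' n -> x = x') ->
  countable a.
Proof.
  intros HR Ht Hu Hi. destruct (function_graph R a omega HR Ht) as (f & Hf & E).
  { intros x n n' Hx _ _. apply Hu, Hx. }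
  exists f. split; [exact Hf|]. intros x x' n H H'. apply E in H, H'.
  apply (Hi x x' n); tauto.
Qed.

Lemma countable_subset (a b : M) : b ⊆ a -> countable a -> countable b.
Proof.
  intros Hb (e & He & Hi). apply (countable_intro (fun x n => opair x n ∈ e)).
  - definability.
  - intros x Hx. apply (function_total e a); auto.
  - intros x n n' Hx. apply (function_unique e a omega x n n' He).
  - intros x x' n Hx Hx'. apply Hi.
Qed.

(** The new element [a] takes the value [empty] and all old values are shifted by [succ]. The two
    clauses do not overlap because [a ∉ a]. *)
Lemma countable_succ (a : M) : countable a -> countable (succ a).
Proof.
  intros (e & He & Hi). apply (countable_intro (fun x n =>
    (x = a /\ n = empty) \/ (exists m, opair x m ∈ e /\ n = succ m))).
  - definability.
  - intros x Hx. apply in_succ in Hx. destruct Hx as [Hx| ->].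
    + destruct (function_total e a omega x He Hx) as (m & Hm & H).
      exists (succ m). split; [apply succ_in_omega, Hm | eauto].
    + exists empty. split; [apply empty_in_omega | auto].
  - intros x n n' _. assert (N : forall m, opair a m ∉ e).
    { intros m Hm. apply (not_mem_self a), (function_dom _ _ _ _ _ He Hm). }
    intros [[-> ->]|(m & H & ->)] [[E ->]|(m' & H' & ->)]; subst; try easy.
    + destruct (N _ H').
    + destruct (N _ H).
    + f_equal. exact (function_unique _ _ _ _ _ _ He H H').
  - intros x x' n _ _ [[-> ->]|(m & H & ->)] [[-> E]|(m' & H' & E)]; auto.
    + destruct (succ_neq_empty m'). auto.
    + destruct (succ_neq_empty m). auto.
    + apply succ_inj in E. subst m'. exact (Hi _ _ _ H H').
Qed.

Lemma countable_omega : countable (omega : M).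
Proof.
  apply (countable_intro eq).
  - definability.
  - eauto.
  - congruence.
  - congruence.
Qed.

Lemma in_countable_subsets (X z : M) :
  z ∈ countable_subsets X <-> z ⊆ X /\ countable z.
Proof.
  apply (in_setof (pow X) (fun z => z ⊆ X /\ countable z)); [definability|].
  intros x [H _]. apply in_pow, H.
Qed.

Lemma in_finite_subsets (X z : M) : z ∈ finite_subsets X <-> z ⊆ X /\ finite z.
Proof.
  apply (in_setof (pow X) (fun z => z ⊆ X /\ finite z)); [definability|].
  intros x [H _]. apply in_pow, H.
Qed.

Lemma finite_empty : finite (empty : M).
Proof.
  exists empty, empty. repeat split; try (intros; exfalso; eapply in_empty; eassumption).
  apply empty_in_omega.
Qed.

Lemma finite_singleton (u : M) : finite (pair u u).
Proof.
  destruct (function_graph (fun _ y => y = empty) (pair u u) (succ empty))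
    as (f & Hf & E).
  - definability.
  - intros x _. exists empty. rewrite in_succ. auto.
  - congruence.
  - exists (succ empty), f. split; [apply succ_in_omega, empty_in_omega|].
    split; [split; [exact Hf|]|].
    + intros x x' y H H'. apply E in H, H'. rewrite in_pair in *. intuition congruence.
    + intros y Hy. exists u. apply E. rewrite in_pair. split; [auto|].
      split; [exact Hy|]. apply in_succ in Hy. destruct Hy as [Hy|Hy]; [|exact Hy].
      destruct (in_empty y Hy).
Qed.

(** * Open sets of the two kinds of spaces *)

Lemma in_S_topology (A X Z V : M) : V ∈ S_topology A X Z <->
  V ⊆ A /\ forall x, x ∈ V -> exists z, z ∈ Z /\ cap x z = empty /\
    forall y, y ∈ A -> x ⊆ y -> y ⊆ diff X z -> y ∈ V.
Proof.
  unfold S_topology. rewrite (in_setof (pow A)).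
  - assert (E : forall x z y, y ∈ {{ y | y ∈ A /\ x ⊆ y /\ y ⊆ diff X z }} <->
      y ∈ A /\ x ⊆ y /\ y ⊆ diff X z).
    { intros x z. apply (in_setof A); [definability | tauto]. }
    split; intros [HV H]; (split; [exact HV|]); intros x Hx;
      destruct (H x Hx) as (z & Hz & Ez & K); exists z; (split; [exact Hz|]);
      (split; [exact Ez|]).
    + intros y Hy Hxy Hyz. apply K, E. auto.
    + intros y Hy. apply E in Hy. apply K; tauto.
  - definability.
  - intros U [HU _]. apply in_pow, HU.
Qed.

Lemma in_cylinder (X p f : M) : f ∈ cylinder X p <-> f ∈ funs X two /\ p ⊆ f.
Proof.
  apply (in_setof (funs X two) (fun f => f ∈ funs X two /\ p ⊆ f));
    [definability | tauto].
Qed.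

Lemma in_cylinder_topology (X Z V : M) : V ∈ cylinder_topology X Z <->
  V ⊆ funs X two /\ forall f, f ∈ V -> exists z p, z ∈ Z /\ z <> empty /\
    p ∈ funs z two /\ f ∈ cylinder X p /\ cylinder X p ⊆ V.
Proof.
  apply (in_setof (pow (funs X two)) (fun V =>
    V ⊆ funs X two /\ forall f, f ∈ V -> exists z p, z ∈ Z /\ z <> empty /\
    p ∈ funs z two /\ f ∈ cylinder X p /\ cylinder X p ⊆ V)).
  - unfold funs, cylinder. definability.
  - intros U [HU _]. apply in_pow, HU.
Qed.

(** * The first uncountable ordinal *)

Context (w1 : M) (Hw1 : first_uncountable_ordinal w1).

Lemma w1_subset (a : M) : a ∈ w1 -> a ⊆ w1.
Proof. apply Hw1. Qed.

Lemma w1_trans (x y z : M) : z ∈ w1 -> x ∈ y -> y ∈ z -> x ∈ z.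
Proof.
  intros Hz Hx Hy.
  assert (Hyw : y ∈ w1) by (apply (w1_subset z); assumption).
  assert (Hxw : x ∈ w1) by (apply (w1_subset y); assumption).
  destruct Hw1 as [[_ (_ & K & _)] _]. apply (K x y z); assumption.
Qed.

Lemma w1_trichotomy (x y : M) : x ∈ w1 -> y ∈ w1 -> x ∈ y \/ x = y \/ y ∈ x.
Proof. destruct Hw1 as [[_ (_ & _ & H & _)] _]. apply H. Qed.

Lemma w1_countable (a : M) : a ∈ w1 -> countable a.
Proof. apply Hw1. Qed.

(** Least elements take the place of choice later on. [P] has to be definable so that its instances
    in [w1] form a set, to which the well-order applies. *)
Lemma w1_least (P : M -> Prop) : definable (fun v => P (v 0)) ->
  (exists a, a ∈ w1 /\ P a) ->
  exists a, a ∈ w1 /\ P a /\ forall b, b ∈ a -> ~ P b.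
Proof.
  intros HP (a & Ha & Pa). destruct (separation P w1 HP) as [s Hs].
  destruct Hw1 as [[_ (_ & _ & _ & H)] _]. destruct (H s) as (m & Hm & L).
  - intros u Hu. apply Hs, Hu.
  - intro E. apply (in_empty a). rewrite <- E. apply Hs. auto.
  - exists m. apply Hs in Hm. split; [tauto|]. split; [tauto|].
    intros b Hb Pb. destruct (L b) as [E|E].
    + apply Hs. split; [apply (w1_subset m); tauto | exact Pb].
    + subst b. exact (not_mem_self m Hb).
    + exact (mem_asym _ _ E Hb).
Qed.

(** Some member of [w1] lies outside [succ a], since otherwise [w1] would be countable. The least
    such member is [succ a] itself. *)
Lemma w1_limit (a : M) : a ∈ w1 -> succ a ∈ w1.
Proof.
  intro Ha.
  destruct (w1_least (fun m => m ∉ succ a)) as (m & Hm & N & L).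
  - definability.
  - apply NNPP. intro K. apply Hw1. apply countable_subset with (succ a).
    + intros u Hu. apply NNPP. eauto.
    + apply countable_succ, w1_countable, Ha.
  - replace (succ a) with m; [exact Hm|]. rewrite in_succ in N.
    assert (Ham : a ∈ m).
    { destruct (w1_trichotomy a m Ha Hm) as [H|[H|H]]; [exact H | |];
        destruct N; auto. }
    apply ext. intro u. split.
    + intro Hu. apply NNPP. exact (L u Hu).
    + rewrite in_succ. intros [Hu| ->]; [|exact Ham].
      apply (w1_trans u a m); assumption.
Qed.

Lemma empty_in_w1 : empty ∈ w1.
Proof.
  destruct (w1_least (fun _ => True)) as (m & Hm & _ & L).
  - definability.
  - apply NNPP. intro K. apply Hw1. apply countable_subset with empty.
    + intros u Hu. destruct K. eauto.
    + apply (countable_subset omega).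
      * intros u Hu. destruct (in_empty u Hu).
      * apply countable_omega.
  - replace empty with m; [exact Hm|]. apply eq_empty.
    intros u Hu. exact (L u Hu I).
Qed.

(** As for successors, uncountability gives a least member [m] of [w1] outside [omega]. By
    transitivity of [omega], no natural number has [m] as a member, hence [m = omega]. *)
Lemma omega_in_w1 : omega ∈ w1.
Proof.
  assert (S : omega ⊆ w1).
  { refine (omega_ind (fun n => n ∈ w1) _ _ _).
    - definability.
    - apply empty_in_w1.
    - intros n _. apply w1_limit. }
  destruct (w1_least (fun m => m ∉ omega)) as (m & Hm & N & L).
  - definability.
  - apply NNPP. intro K. apply Hw1. apply countable_subset with omega.
    + intros u Hu. apply NNPP. eauto.
    + apply countable_omega.
  - replace omega with m; [exact Hm|]. apply ext. intro u. split.
    + intro Hu. apply NNPP. exact (L u Hu).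
    + intro Hu. destruct (w1_trichotomy u m (S u Hu) Hm) as [?|[->|H]].
      * assumption.
      * destruct (N Hu).
      * destruct (N (omega_transitive u Hu m H)).
Qed.

(** * Regularity and bounds for countable families *)

Definition regular : Prop := forall c f, c ∈ w1 -> ~ cofinal_map f c w1.

(** [regular] is the minimality clause of [is_cofinality w1 w1]; the identity map of [w1] supplies
    the cofinal map that the definition asks for. *)
Lemma is_cofinality_iff_regular : is_cofinality w1 w1 <-> regular.
Proof.
  split.
  - intros (_ & _ & H) c f Hc Hf. apply (H c Hc). eauto.
  - intro H. split; [apply Hw1|]. split.
    + destruct (function_graph eq w1 w1) as (f & Hf & E).
      * definability.
      * eauto.
      * congruence.
      * exists f. split; [exact Hf|]. intros x Hx. exists x, x.
        split; [apply E|]; auto.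
    + intros c Hc [f Hf]. exact (H c f Hc Hf).
Qed.

(* Least witnesses replace the choice of one witness for each member of [F]. *)
Lemma regular_bound (R : M -> M -> Prop) (F : M) : regular ->
  definable (fun v => R (v 0) (v 1)) -> countable F ->
  (forall V, V ∈ F -> exists a, a ∈ w1 /\ R V a) ->
  exists b, b ∈ w1 /\ forall V, V ∈ F -> exists a, a ∈ b /\ R V a.
Proof.
  intros Hreg HR (e & He & Hi) HF.
  (* [Q] describes the map from [omega] to [w1] that sends the number of a member of [F] to the
     least index for that member. Numbers not taken by [e] get the default value [empty], which
     makes the map total. *)
  pose (Q := fun n a =>
    (exists V, opair V n ∈ e /\ R V a /\ forall a', a' ∈ a -> ~ R V a') \/
    ((forall V, opair V n ∉ e) /\ a = empty)).
  destruct (function_graph Q omega w1) as (h & Hh & E).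
  - unfold Q. definability.
  - intros n Hn. destruct (classic (exists V, opair V n ∈ e)) as [[V HV]|N].
    + destruct (w1_least (R V)) as (a & Ha & Ra & L).
      * definability.
      * apply HF, (function_dom _ _ _ _ _ He HV).
      * exists a. split; [exact Ha|]. left. eauto.
    + exists empty. split; [apply empty_in_w1|]. right. split; [|reflexivity].
      intros V HV. eauto.
  - intros n a a' Hn Ha Ha' [(V & HV & Ra & L)|[N ->]] [(V' & HV' & Ra' & L')|[N' ->]].
    + assert (V' = V) by (apply (Hi V' V n); assumption). subst V'.
      destruct (w1_trichotomy a a' Ha Ha') as [H|[H|H]]; [|exact H|].
      * destruct (L' a H Ra).
      * destruct (L a' H Ra').
    + destruct (N' V HV).
    + destruct (N V' HV').
    + reflexivity.
  (* [h] has domain [omega], a member of [w1], so it is not cofinal. A point that is neither equal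
     to a value of [h] nor below one is, by trichotomy, strictly above all values. *)
  - assert (K : exists b, b ∈ w1 /\ forall t y, opair t y ∈ h -> y ∈ b).
    { apply NNPP. intro K. apply (Hreg omega h omega_in_w1). split; [exact Hh|].
      intros x Hx. apply NNPP. intro N. apply K. exists x. split; [exact Hx|].
      intros t y Hy. destruct (w1_trichotomy x y) as [H|[H|H]]; auto.
      - apply (function_dom _ _ _ _ _ Hh Hy).
      - destruct N. eauto.
      - destruct N. eauto. }
    destruct K as (b & Hb & K). exists b. split; [exact Hb|]. intros V HV.
    destruct (function_total _ _ _ _ He HV) as (n & Hn & HVn).
    destruct (function_total _ _ _ _ Hh Hn) as (a & Ha & Hna).
    exists a. split; [exact (K n a Hna)|].
    apply E in Hna. destruct Hna as (_ & _ & [(V' & HV' & H & _)|[N _]]).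
    + rewrite (Hi V V' n); assumption.
    + destruct (N V HVn).
Qed.

(** Each member of [z] serves as its own index. The bound from [regular_bound] is strict, so it
    contains [z] as a subset. *)
Lemma countable_bounded (z : M) : regular -> z ⊆ w1 -> countable z ->
  exists a, a ∈ w1 /\ z ⊆ a.
Proof.
  intros Hreg Hz Cz. destruct (regular_bound eq z Hreg) as (b & Hb & K).
  - definability.
  - exact Cz.
  - intros u Hu. exists u. auto.
  - exists b. split; [exact Hb|]. intros u Hu.
    destruct (K u Hu) as (a & Ha & ->). exact Ha.
Qed.

Lemma w1_in_countable_subsets (a : M) : a ∈ w1 -> a ∈ countable_subsets w1.
Proof.
  intro Ha. apply in_countable_subsets. split; [apply w1_subset | apply w1_countable];
    exact Ha.
Qed.

Lemma w1_directed (a b : M) : a ∈ w1 -> b ∈ w1 ->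
  exists c, c ∈ w1 /\ a ⊆ c /\ b ⊆ c.
Proof.
  intros Ha Hb. destruct (w1_trichotomy a b Ha Hb) as [H|[<-|H]].
  - exists b. split; [exact Hb|]. split; [|intro; auto].
    intros u Hu. apply (w1_trans u a b); assumption.
  - exists a. split; [exact Ha|]. split; intro; auto.
  - exists a. split; [exact Ha|]. split; [intro; auto|].
    intros u Hu. apply (w1_trans u b a); assumption.
Qed.

(** * The sigma-ideal condition *)

Lemma sigma_ideal_of_regular : regular -> sigma_ideal (countable_subsets w1).
Proof.
  intro Hreg.
  assert (B : forall z, z ∈ countable_subsets w1 <->
    exists a, a ∈ w1 /\ z ⊆ a).
  { intro z. rewrite in_countable_subsets. split.
    - intros [Hz Cz]. apply countable_bounded; assumption.
    - intros (a & Ha & Hz). split.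
      + intros u Hu. apply (w1_subset a Ha), Hz, Hu.
      + apply (countable_subset a); [exact Hz | apply w1_countable, Ha]. }
  split; [split; [|split]|].
  - apply w1_in_countable_subsets, empty_in_w1.
  - intros x y Hx Hy. apply B in Hx. destruct Hx as (a & Ha & Hx). apply B.
    exists a. split; [exact Ha|]. intros u Hu. apply Hx, Hy, Hu.
  - intros x y Hx Hy. apply B in Hx, Hy.
    destruct Hx as (a & Ha & Hx), Hy as (b & Hb & Hy).
    destruct (w1_directed a b Ha Hb) as (c & Hc & Hac & Hbc). apply B. exists c.
    split; [exact Hc|]. intros u Hu. apply in_cup in Hu. destruct Hu; auto.
  - intros s Hs. apply B.
    (* The index of [n] is a bound of the [n]-th set. If all these indices lie in [b], the union is
       a subset of [b], hence bounded. *)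
    destruct (regular_bound (fun n a => forall z, opair n z ∈ s -> z ⊆ a)
      omega Hreg) as (b & Hb & K).
    + definability.
    + apply countable_omega.
    + intros n Hn. destruct (function_total _ _ _ _ Hs Hn) as (z & Hz & Hnz).
      apply B in Hz. destruct Hz as (a & Ha & Hz). exists a. split; [exact Ha|].
      intros z' Hz'. rewrite (function_unique _ _ _ _ _ _ Hs Hz' Hnz). exact Hz.
    + exists b. split; [exact Hb|]. intros u Hu. apply in_bigcup in Hu.
      destruct Hu as (z & Hz & Hu). apply in_range in Hz. destruct Hz as (n & Hn).
      destruct (K n) as (a & Ha & Hz).
      * apply (function_dom _ _ _ _ _ Hs Hn).
      * apply (w1_trans u a b Hb); [exact (Hz z Hn u Hu) | exact Ha].
Qed.

Lemma regular_of_sigma_ideal : sigma_ideal (countable_subsets w1) -> regular.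
Proof.
  intros [[_ [Hsub _]] Hunion] c f Hc [Hf Hcof].
  destruct (w1_countable c Hc) as (e & He & Hi).
  (* The enumeration [e] of [c] turns the family of the sets [succ (f t)] into a sequence over
     [omega], with [empty] at the numbers that [e] does not take. Using [succ u] instead of [u] lets
     a point equal to a value of [f] be covered too. *)
  pose (Q := fun n y =>
    (exists t u, opair t n ∈ e /\ opair t u ∈ f /\ y = succ u) \/
    ((forall t, opair t n ∉ e) /\ y = empty)).
  destruct (function_graph Q omega (countable_subsets w1)) as (s & Hs & E).
  - unfold Q. definability.
  - intros n Hn. destruct (classic (exists t, opair t n ∈ e)) as [[t Ht]|N].
    + destruct (function_total f c w1 t) as (u & Hu & Htu).
      * exact Hf.
      * apply (function_dom _ _ _ _ _ He Ht).
      * exists (succ u). split; [apply w1_in_countable_subsets, w1_limit, Hu|].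
        left. eauto.
    + exists empty. split; [apply w1_in_countable_subsets, empty_in_w1|].
      right. split; [|reflexivity]. intros t Ht. eauto.
  - intros n y y' _ _ _ [(t & u & Ht & Hu & ->)|[N ->]]
      [(t' & u' & Ht' & Hu' & ->)|[N' ->]].
    + assert (t' = t) by (apply (Hi t' t n); assumption). subst t'.
      f_equal. exact (function_unique _ _ _ _ _ _ Hf Hu Hu').
    + destruct (N' t Ht).
    + destruct (N t' Ht').
    + reflexivity.
  - apply Hw1. apply (in_countable_subsets w1 w1).
    apply Hsub with (bigcup (range s)); [apply Hunion, Hs|].
    intros x Hx. destruct (Hcof x Hx) as (t & u & Hu & Hxu).
    destruct (function_dom _ _ _ _ _ Hf Hu) as [Ht Hu1].
    destruct (function_total _ _ _ _ He Ht) as (n & Hn & Htn).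
    apply in_bigcup. exists (succ u). split.
    + apply in_range. exists n. apply E. split; [exact Hn|].
      split; [apply w1_in_countable_subsets, w1_limit, Hu1|]. left. eauto.
    + apply in_succ. tauto.
Qed.

(** * The P-space conditions *)

(** [N x y a] is read as: [y] lies in the basic neighbourhood of [x] with index [a]. Neighbourhoods
    shrink as the index grows, so the larger of two indices serves an intersection of two open sets,
    and a bound from [regular_bound] serves a countable intersection. *)
Lemma P_space_of_basic_nbhds (A tau : M) (N : M -> M -> M -> Prop) : regular ->
  definable (fun v => N (v 0) (v 1) (v 2)) ->
  (forall x y a b, a ⊆ b -> N x y b -> N x y a) ->
  (forall V, V ∈ tau <-> V ⊆ A /\ forall x, x ∈ V ->
     exists a, a ∈ w1 /\ forall y, y ∈ A -> N x y a -> y ∈ V) ->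
  P_space A tau.
Proof.
  intros Hreg HN Hmono Htau. split; [repeat split|].
  - intros V HV. apply in_pow, Htau, HV.
  - apply Htau. split; intros x Hx; destruct (in_empty x Hx).
  - apply Htau. split; [intro; auto|]. intros x _. exists empty.
    split; [apply empty_in_w1 | auto].
  - intros F HF. apply Htau. split.
    + intros x Hx. apply in_bigcup in Hx. destruct Hx as (V & HV & Hx).
      apply HF, Htau in HV. apply HV, Hx.
    + intros x Hx. apply in_bigcup in Hx. destruct Hx as (V & HV & Hx).
      pose proof (HF V HV) as HV'. apply Htau in HV'.
      destruct (proj2 HV' x Hx) as (a & Ha & K).
      exists a. split; [exact Ha|]. intros y Hy Hn. apply in_bigcup. eauto.
  - intros V W HV HW. apply Htau in HV, HW. apply Htau. split.
    + intros x Hx. apply in_cap in Hx. apply HV, Hx.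
    + intros x Hx. apply in_cap in Hx.
      destruct (proj2 HV x) as (a & Ha & Ka); [apply Hx|].
      destruct (proj2 HW x) as (b & Hb & Kb); [apply Hx|].
      destruct (w1_directed a b Ha Hb) as (c & Hc & Hac & Hbc). exists c.
      split; [exact Hc|]. intros y Hy Hn. apply in_cap.
      split; [apply Ka | apply Kb]; eauto.
  - intros G (F & CF & HF & ->). apply Htau.
    assert (E : forall x, x ∈ {{ x | x ∈ A /\ forall V, V ∈ F -> x ∈ V }} <->
      x ∈ A /\ forall V, V ∈ F -> x ∈ V).
    { apply (in_setof A); [definability | tauto]. }
    split; [intros x Hx; exact (proj1 (proj1 (E x) Hx))|]. intros x Hx. apply E in Hx.
    destruct (regular_bound (fun V a => forall y, y ∈ A -> N x y a -> y ∈ V) F Hreg)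
      as (b & Hb & K).
    + definability.
    + exact CF.
    + intros V HV. pose proof (HF V HV) as HV'. apply Htau in HV'.
      apply HV'. apply Hx, HV.
    + exists b. split; [exact Hb|]. intros y Hy Hn. apply E. split; [exact Hy|].
      intros V HV. destruct (K V HV) as (a & Ha & Ka). apply Ka; [exact Hy|].
      apply Hmono with b; [|exact Hn]. intros u Hu. apply (w1_trans u a b); assumption.
Qed.

(* Regularity bounds a countable [z] by some [a] in [w1], so the sets
   [z = a \ x] give a neighbourhood base at [x]. *)
Lemma P_space_S_topology (A : M) : regular ->
  A ⊆ pow w1 -> P_space A (S_topology A w1 (countable_subsets w1)).
Proof.
  intros Hreg HA.
  apply P_space_of_basic_nbhds with
    (* The second clause says that [y] misses [a \ x]. *)
    (N := fun x y a => x ⊆ y /\ forall u, u ∈ y -> u ∈ a -> u ∈ x).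
  - exact Hreg.
  - definability.
  - intros x y a b Hab [Hxy H]. split; auto.
  - intro V. rewrite in_S_topology.
    split; intros [HV H]; (split; [exact HV|]); intros x Hx.
    + destruct (H x Hx) as (z & Hz & Ez & K). apply in_countable_subsets in Hz.
      destruct (countable_bounded z Hreg) as (a & Ha & Hza); [apply Hz..|].
      exists a. split; [exact Ha|]. intros y Hy [Hxy Hn].
      apply K; [exact Hy | exact Hxy |]. intros u Hu. apply in_diff. split.
      * apply HA, in_pow in Hy. exact (Hy u Hu).
      * intro Huz. apply (in_empty u). rewrite <- Ez. apply in_cap. auto.
    + destruct (H x Hx) as (a & Ha & K). exists (diff a x). split; [|split].
      * apply in_countable_subsets. split.
        -- intros u Hu. apply in_diff in Hu. apply (w1_subset a Ha), Hu.
        -- apply (countable_subset a); [|apply w1_countable, Ha].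
           intros u Hu. apply in_diff in Hu. apply Hu.
      * apply eq_empty. intros u Hu. rewrite in_cap, in_diff in Hu. tauto.
      * intros y Hy Hxy Hd. apply K; [exact Hy|]. split; [exact Hxy|].
        intros u Hu Hua. apply Hd in Hu. rewrite !in_diff in Hu.
        apply NNPP. tauto.
Qed.

(** The basic neighbourhood of [f] with index [a] consists of the functions that agree with [f] on
    [a]. If [a] contains the domain of a partial function included in [f], this neighbourhood lies
    in the corresponding cylinder. *)
Lemma P_space_cylinder_topology : regular ->
  P_space (funs w1 two) (cylinder_topology w1 (countable_subsets w1)).
Proof.
  intro Hreg.
  apply P_space_of_basic_nbhds with
    (N := fun f g a => forall t y, t ∈ a -> opair t y ∈ f -> opair t y ∈ g).
  - exact Hreg.
  - definability.
  - intros f g a b Hab H t y Ht. apply H, Hab, Ht.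
  - intro V. rewrite in_cylinder_topology.
    split; intros [HV H]; (split; [exact HV|]); intros f Hf.
    + destruct (H f Hf) as (z & p & Hz & _ & Hp & Hfp & K).
      apply in_countable_subsets in Hz.
      destruct (countable_bounded z Hreg) as (a & Ha & Hza); [apply Hz..|].
      exists a. split; [exact Ha|]. intros g Hg Hn. apply K, in_cylinder.
      split; [exact Hg|]. intros q Hq. apply in_funs in Hp.
      destruct (proj1 Hp q Hq) as (t & y & Ht & Hy & ->).
      apply Hn; [apply Hza, Ht|]. apply in_cylinder in Hfp. apply Hfp, Hq.
    + destruct (H f Hf) as (a & Ha & K).
      pose proof (HV f Hf) as Ff. apply in_funs in Ff.
      pose proof (w1_limit a Ha) as Hs.
      (* [p] is the restriction of [f] to [succ a]. The domain of a cylinder has to be nonempty,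
         which [a] itself may fail to be. *)
      destruct (function_graph (fun t y => opair t y ∈ f) (succ a) two)
        as (p & Hp & E).
      * definability.
      * intros t Ht. apply (function_total f w1 two); [exact Ff|].
        apply (w1_subset _ Hs), Ht.
      * intros t y y' _ _ _. apply (function_unique f w1 two), Ff.
      * exists (succ a), p. split; [apply w1_in_countable_subsets, Hs|].
        split; [apply succ_neq_empty|]. split; [apply in_funs, Hp|]. split.
        -- apply in_cylinder. split; [apply HV, Hf|]. intros q Hq.
           destruct (proj1 Hp q Hq) as (t & y & Ht & Hy & ->). apply E in Hq.
           apply Hq.
        -- intros g Hg. apply in_cylinder in Hg. destruct Hg as [Hg Hpg].
           apply K; [exact Hg|]. intros t y Ht Hy. apply Hpg, E.
           split; [apply in_succ; auto|]. split; [|exact Hy].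
           apply (function_dom _ _ _ _ _ Ff Hy).
Qed.

(** The argument tests open sets only on [empty] and on singletons, so one proof serves both the
    power set and the finite subsets. *)
Lemma regular_of_P_space (A : M) : A ⊆ pow w1 -> empty ∈ A ->
  (forall u, u ∈ w1 -> pair u u ∈ A) ->
  P_space A (S_topology A w1 (countable_subsets w1)) -> regular.
Proof.
  intros HA A0 A1 [_ HP] c f Hc [Hf Hcof].
  pose (Q := fun t V => exists u, opair t u ∈ f /\
    forall y, y ∈ V <-> y ∈ A /\ forall s, s ∈ y -> s ∉ succ u).
  destruct (separation (fun V => exists t, t ∈ c /\ Q t V) (pow A)) as [F HF].
  { unfold Q. definability. }
  assert (HQ : forall t V V', Q t V -> Q t V' -> V = V').
  { intros t V V' (u & Hu & E) (u' & Hu' & E'). apply ext. intro y.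
    rewrite E, E', (function_unique _ _ _ _ _ _ Hf Hu Hu'). tauto. }
  destruct (w1_countable c Hc) as (e & He & Hi).
  assert (CF : countable F).
  (* Different [t] may give the same open set, so [V] is numbered through the least [t] that gives
     it. *)
  { apply (countable_intro (fun V n => exists t, opair t n ∈ e /\ Q t V /\
      forall t', t' ∈ t -> ~ Q t' V)).
    - unfold Q. definability.
    - intros V HV. apply HF in HV. destruct HV as (_ & t & Ht & HV).
      destruct (w1_least (fun t => t ∈ c /\ Q t V)) as (m & Hm & [Hmc Qm] & L).
      + unfold Q. definability.
      + exists t. split; [apply (w1_subset c Hc), Ht | auto].
      + destruct (function_total _ _ _ _ He Hmc) as (n & Hn & Hmn).
        exists n. split; [exact Hn|]. exists m. split; [exact Hmn|].
        split; [exact Qm|]. intros t' Ht' Qt'. apply (L t' Ht').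
        split; [|exact Qt']. apply (w1_trans t' m c); assumption.
    - intros V n n' _ (t & Ht & Qt & L) (t' & Ht' & Qt' & L').
      assert (t = t').
      { destruct (w1_trichotomy t t') as [H|[H|H]].
        - apply (w1_subset c Hc), (function_dom _ _ _ _ _ He Ht).
        - apply (w1_subset c Hc), (function_dom _ _ _ _ _ He Ht').
        - destruct (L' t H Qt).
        - exact H.
        - destruct (L t' H Qt'). }
      subst t'. exact (function_unique _ _ _ _ _ _ He Ht Ht').
    - intros V V' n _ _ (t & Ht & Qt & _) (t' & Ht' & Qt' & _).
      rewrite (Hi t' t n Ht' Ht) in Qt'. exact (HQ t V V' Qt Qt'). }
  assert (HG : {{ x | x ∈ A /\ forall V, V ∈ F -> x ∈ V }} ∈
    S_topology A w1 (countable_subsets w1)).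
  { apply HP. exists F. split; [exact CF|]. split; [|reflexivity].
    intros V HV. apply HF in HV. destruct HV as (HVA & t & Ht & u & Hu & E).
    apply in_S_topology. split; [apply in_pow, HVA|]. intros x Hx. apply E in Hx.
    (* The same [z] works at every point of [V]: all [y] in [A] that miss [succ u] belong to [V]. *)
    exists (succ u). split; [|split].
    - apply w1_in_countable_subsets, w1_limit, (function_dom _ _ _ _ _ Hf Hu).
    - apply eq_empty. intros s Hs. apply in_cap in Hs. apply (proj2 Hx s); apply Hs.
    - intros y Hy _ Hd. apply E. split; [exact Hy|]. intros s Hs.
      apply Hd in Hs. apply in_diff in Hs. apply Hs. }
  assert (EG : forall x, x ∈ {{ x | x ∈ A /\ forall V, V ∈ F -> x ∈ V }} <->
      x ∈ A /\ forall V, V ∈ F -> x ∈ V).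
  { apply (in_setof A); [definability | tauto]. }
  apply in_S_topology in HG. destruct HG as [_ HG].
  destruct (HG empty) as (z & Hz & _ & K).
  { apply EG. split; [exact A0|]. intros V HV. apply HF in HV.
    destruct HV as (_ & t & _ & u & _ & E). apply E. split; [exact A0|].
    intros s Hs. destruct (in_empty s Hs). }
  apply in_countable_subsets in Hz. apply Hw1.
  (* A point [x] outside [z] would put its singleton into the neighbourhood of [empty] given by [z],
     hence into the intersection. But cofinality yields a value [u] of [f] with [x ∈ succ u], and
     the singleton does not miss [succ u]. *)
  apply (countable_subset z); [|apply Hz]. intros x Hx. apply NNPP. intro Nz.
  assert (Gx : pair x x ∈ {{ x | x ∈ A /\ forall V, V ∈ F -> x ∈ V }}).
  { apply K; [apply A1, Hx | |].
    - intros s Hs. destruct (in_empty s Hs).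
    - intros s Hs. apply in_pair in Hs. apply in_diff.
      assert (s = x) by tauto. subst s. auto. }
  apply EG in Gx. destruct Gx as [_ Gx].
  destruct (Hcof x Hx) as (t & u & Hu & Hxu).
  destruct (separation (fun y => forall s, s ∈ y -> s ∉ succ u) A) as [V HV].
  { definability. }
  assert (HVx : pair x x ∈ V).
  { apply Gx, HF. split.
    - apply in_pow. intros y Hy. apply HV, Hy.
    - exists t. split; [apply (function_dom _ _ _ _ _ Hf Hu)|]. exists u. auto. }
  apply HV in HVx. apply (proj2 HVx x); [apply in_pair; auto|].
  apply in_succ. tauto.
Qed.

(** * Assembly of the equivalences *)

Lemma regular_iff_P_space_S_topology (A : M) : A ⊆ pow w1 -> empty ∈ A ->
  (forall u, u ∈ w1 -> pair u u ∈ A) ->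
  regular <-> P_space A (S_topology A w1 (countable_subsets w1)).
Proof.
  intros HA A0 A1. split.
  - intro Hreg. apply P_space_S_topology; assumption.
  - apply regular_of_P_space; assumption.
Qed.

Lemma omega1_equivalences :
  (sigma_ideal (countable_subsets w1) <-> regular) /\
  (P_space (pow w1) (S_topology (pow w1) w1 (countable_subsets w1)) <-> regular) /\
  (P_space (finite_subsets w1)
     (S_topology (finite_subsets w1) w1 (countable_subsets w1)) <-> regular).
Proof.
  assert (S1 : forall u, u ∈ w1 -> pair u u ⊆ w1).
  { intros u Hu s Hs. apply in_pair in Hs. destruct Hs; subst; exact Hu. }
  split; [|split].
  - split; [exact regular_of_sigma_ideal | exact sigma_ideal_of_regular].
  - symmetry. apply regular_iff_P_space_S_topology.
    + intro; auto.
    + apply in_pow, w1_subset, empty_in_w1.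
    + intros u Hu. apply in_pow, S1, Hu.
  - symmetry. apply regular_iff_P_space_S_topology.
    + intros x Hx. apply in_finite_subsets in Hx. apply in_pow, Hx.
    + apply in_finite_subsets.
      split; [apply w1_subset, empty_in_w1 | apply finite_empty].
    + intros u Hu. apply in_finite_subsets. split; [apply S1, Hu | apply finite_singleton].
Qed.

End Model.

Theorem theorem5p4 (M : set_structure) (HM : ZF M)
    (w1 : M) (Hw1 : first_uncountable_ordinal w1) :
  (sigma_ideal (countable_subsets w1) <-> is_cofinality w1 w1) /\
  (is_cofinality w1 w1 <->
     P_space (pow w1) (S_topology (pow w1) w1 (countable_subsets w1)) /\
     P_space (funs w1 two) (cylinder_topology w1 (countable_subsets w1))) /\
  (P_space (pow w1) (S_topology (pow w1) w1 (countable_subsets w1)) /\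
     P_space (funs w1 two) (cylinder_topology w1 (countable_subsets w1)) <->
   P_space (finite_subsets w1)
     (S_topology (finite_subsets w1) w1 (countable_subsets w1))).
Proof.
  (* All conditions pass through [regular]. The pair of P-space conditions gives regularity through
     the space on [pow w1], and regularity gives both spaces. *)
  pose proof (is_cofinality_iff_regular HM w1 Hw1).
  pose proof (omega1_equivalences HM w1 Hw1).
  pose proof (P_space_cylinder_topology HM w1 Hw1).
  tauto.
Qed.
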